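(* Let $p$ be a prime, $m>2$ with $(p,m)\neq(2,6)$, $n=2m$. Let $\mathcal{P}_1=T(q_1,\alpha,a,b)$ and $\mathcal{P}_2=T(q_2,\alpha',a',b')$ be Taniguchi pre-semifields with $q_1=p^{k_1}$, $q_2=p^{k_2}$, $0<k_1<m/2$ and $0<k_2\le m/2$. Assume that $C_{q_1,\alpha,a,b}$ contains $Z^{(q_1)}$ as a subgroup of index $I$ with $p'\nmid I$. If $\mathcal{P}_1$ and $\mathcal{P}_2$ are isotopic, then there exists an isotopism $(N,L,M)$ from $\mathcal{P}_1$ to $\mathcal{P}_2$ such that all nonzero subfunctions of $L$ and of $M$ are monomials; moreover, all nonzero subfunctions of $L$ have the same degree, and all nonzero subfunctions of $M$ have the same degree (the common degree for $L$ may differ from that for $M$).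
   Context: For $q=p^k$ and $\alpha,a,b\in\mathbb{F}_{p^m}$ with $-\alpha$ not a $(q-1)$-st power in $\mathbb{F}_{p^m}$ and $x^{q+1}+ax+b$ having no root in $\mathbb{F}_{p^m}$, $T(q,\alpha,a,b)$ is $\mathbb{F}_{p^m}\times\mathbb{F}_{p^m}$ with componentwise addition and multiplication $(x,y)\circ(u,v)=\big(x^qu+\alpha^{q^2}xu^q-a(xv^q-\alpha^q uy^q)-b(y^qv+\alpha yv^q),\ xv^{q^2}+y^{q^2}u\big)$. An isotopism from $(P,+,\circ_1)$ to $(P,+,\circ_2)$ is a triple $(N,L,M)$ of $\mathbb{F}_p$-linear bijections of $P$ with $N(x\circ_1y)=L(x)\circ_2M(y)$ for all $x,y$; autotopisms are isotopisms from a pre-semifield to itself, forming the group $\mathrm{Aut}(\mathcal{P})$ under componentwise composition. An $\mathbb{F}_p$-linear map $L$ of $\mathbb{F}_{p^m}\times\mathbb{F}_{p^m}$ is written as $L=\begin{pmatrix}L_1&L_2\\L_3&L_4\end{pmatrix}$, i.e. $L(x,y)=(L_1(x)+L_2(y),L_3(x)+L_4(y))$ with $\mathbb{F}_p$-linear $L_i:\mathbb{F}_{p^m}\to\mathbb{F}_{p^m}$, the subfunctions of $L$; a monomial is a map $z\mapsto cz^{p^j}$ with $c\ne0$, of degree $p^j$. $m_r$ is multiplication by $r$, $\mathrm{diag}(A,B)$ is $(x,y)\mapsto(A(x),B(y))$, $\gamma_r=(\mathrm{diag}(m_{r^{q+1}},m_{r^{q^2+1}}),\mathrm{diag}(m_r,m_r),\mathrm{diag}(m_r,m_r))$,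 $Z^{(q)}=\{\gamma_r:r\in\mathbb{F}_{p^m}^*\}$. $p'$ is a fixed $p$-primitive prime divisor of $p^m-1$ (i.e. $p'\mid p^m-1$, $p'\nmid p^j-1$ for $1\le j<m$), $R$ is the Sylow $p'$-subgroup of $\mathbb{F}_{p^m}^*$, $Z_R^{(q)}=\{\gamma_r:r\in R\}$, and $C_{q,\alpha,a,b}$ is the centralizer of $Z_R^{(q)}$ in $\mathrm{Aut}(T(q,\alpha,a,b))$. *)

(* Defs.v *)
From HB Require Import structures.
From mathcomp Require Import all_boot all_order all_algebra all_fingroup.
From mathcomp Require Import all_solvable.

Set Implicit Arguments.
Unset Strict Implicit.
Unset Printing Implicit Defensive.

Import GRing.Theory.
Local Open Scope ring_scope.

(* The library leaves this join of structures undeclared. *)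
HB.instance Definition _ (U V : finZmodType) := GRing.Zmodule.on (U * V)%type.

Section Isotopism.
Variables (p : nat) (V : finZmodType).
Implicit Types (f : V -> V) (mul : V -> V -> V).

(* The scalar c in F_p acts on an abelian group of exponent p as the natural
   number multiple _ *+ c. *)
Definition Fp_linear f : bool :=
  [forall c : 'F_p, forall u, forall v, f (u *+ c + v) == f u *+ c + f v].

(* The group law of {perm V} is (s * t) x = t (s x), so this is the opposite of
   the usual componentwise composition; subgroups, centralizers and indices
   are the same. *)
Definition triple : finGroupType := ({perm V} * {perm V} * {perm V})%type.

Definition isotopism mul1 mul2 (t : triple) : bool :=
  let: (N, L, M) := t in
  [&& Fp_linear N, Fp_linear L, Fp_linear M
    & [forall x, forall y, N (mul1 x y) == mul2 (L x) (M y)]].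

Definition isotopic mul1 mul2 : Prop := exists t, isotopism mul1 mul2 t.

Definition autotopisms mul : {set triple} := [set t | isotopism mul mul t].

Lemma autotopisms_group_set mul : group_set (autotopisms mul).
Proof.
apply/group_setP; split=> [|[[N L] M] [[N' L'] M']].
  rewrite inE /isotopism /=; apply/and4P; split; do ?[apply/forallP => ?];
    do ?[apply/forallP => ?]; by do ?[apply/forallP => ?]; rewrite !perm1.
have comp (A B : {perm V}) : Fp_linear A -> Fp_linear B -> Fp_linear (A * B)%g.
  move=> /forallP hA /forallP hB; apply/forallP => c.
  apply/forallP => u; apply/forallP => v.
  move: (hA c) => /forallP/(_ u)/forallP/(_ v)/eqP eA.
  move: (hB c) => /forallP/(_ (A u))/forallP/(_ (A v))/eqP eB.
  by rewrite !permM eA eB.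
rewrite !inE /= => /and4P[N1 L1 M1 /forallP h1] /and4P[N2 L2 M2 /forallP h2].
rewrite !comp //=; apply/forallP => x; apply/forallP => y.
move/forallP: (h1 x) => /(_ y)/eqP e1.
move/forallP: (h2 (L x)) => /(_ (M y))/eqP e2.
by rewrite !permM e1 e2.
Qed.

Canonical autotopisms_group mul := Group (autotopisms_group_set mul).

End Isotopism.

Section Taniguchi.
Variable F : finFieldType.
Implicit Types (q : nat) (alpha a b : F) (r : {unit F}).

Definition taniguchi_params q alpha a b : Prop :=
  (forall z : F, z ^+ (q - 1) != - alpha) /\
  (forall z : F, ~~ root ('X^(q + 1) + a *: 'X + b%:P) z).

Definition taniguchi q alpha a b (s t : F * F) : F * F :=
  let: (x, y) := s in let: (u, v) := t in
  (x ^+ q * u + alpha ^+ (q ^ 2) * x * u ^+ q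
     - a * (x * v ^+ q - alpha ^+ q * u * y ^+ q)
     - b * (y ^+ q * v + alpha * y * v ^+ q),
   x * v ^+ (q ^ 2) + y ^+ (q ^ 2) * u).

Definition mulp r : {perm F} := perm (mulrI (valP r)).

Lemma diag_inj (A B : {perm F}) :
  injective (fun s : F * F => (A s.1, B s.2)).
Proof. by move=> [x y] [u v] /= [/perm_inj-> /perm_inj->]. Qed.

Definition diag (A B : {perm F}) : {perm (F * F)} := perm (@diag_inj A B).

Definition gamma q r : triple (F * F)%type :=
  (diag (mulp (r ^+ (q + 1))%g) (mulp (r ^+ (q ^ 2 + 1))%g),
   diag (mulp r) (mulp r), diag (mulp r) (mulp r)).

Lemma gammaM q : {morph gamma q : r s / (r * s)%g}.
Proof.
have D r s r' s' : diag (mulp (r * s)%g) (mulp (r' * s')%g)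
    = (diag (mulp r) (mulp r') * diag (mulp s) (mulp s'))%g.
  apply/permP => -[x y]; rewrite permM !permE /= ?permE /=.
  by congr (_, _); rewrite mulrCA mulrA.
move=> r s; have rs : commute r s by apply: val_inj; rewrite /= mulrC.
by rewrite /gamma !expgMn // !D.
Qed.

Canonical gamma_morphism q :=
  @Morphism _ _ [set: {unit F}] (gamma q) (in2W (gammaM q)).

(* Z^(q) is taniguchi_Z q [set: {unit F}], and Z_R^(q) is taniguchi_Z q R. *)
Definition taniguchi_Z q (R : {set {unit F}}) : {set triple (F * F)%type} :=
  [set gamma q r | r in R].

Lemma taniguchi_Z_group_set q (R : {group {unit F}}) :
  group_set (taniguchi_Z q R).
Proof. by rewrite /taniguchi_Z -morphimEsub ?subsetT // groupP. Qed.

Canonical taniguchi_Z_group q (R : {group {unit F}}) :=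
  Group (taniguchi_Z_group_set q R).

Definition taniguchi_C p q alpha a b (R : {set {unit F}}) :
    {set triple (F * F)%type} :=
  'C_(autotopisms p (taniguchi q alpha a b))(taniguchi_Z q R)%g.

(* The entries L_1, L_2, L_3, L_4 of
   L(x, y) = (L_1(x) + L_2(y), L_3(x) + L_4(y)), for an additive L. *)
Definition subfunctions (L : F * F -> F * F) : seq {ffun F -> F} :=
  [:: [ffun x => (L (x, 0)).1]; [ffun y => (L (0, y)).1];
      [ffun x => (L (x, 0)).2]; [ffun y => (L (0, y)).2]].

Definition monomial (d : nat) (f : F -> F) : Prop :=
  exists2 c : F, c != 0 & forall z, f z = c * z ^+ d.

End Taniguchi.

Definition primitive_prime_divisor (p m p' : nat) : Prop :=
  [/\ prime p', p' %| p ^ m - 1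
    & forall j, 1 <= j < m -> ~~ (p' %| p ^ j - 1)]%N.

(* Main.v *)
(* A normalizing p'-element of Aut(P1) conjugates gamma_r, r a generator of R,
   to some gamma_s, and the entries of its second component are additive maps f
   with f(r z) = s f(z). Such an s is a conjugate r^(p^j) of r over F_p and
   such an f is c z^(p^j). Since r |-> r^(p^j) has order dividing m, which is
   prime to p', the element centralizes Z_R; with the index hypothesis this
   makes Z_R a Sylow p'-subgroup of Aut(P1). An isotopism from P1 to P2 carries
   the group Z_R of P2 to another Sylow p'-subgroup, so after composing with an
   autotopism of P1 it conjugates gamma_r for P1 to some gamma_s for P2, and
   the same eigenvector argument applies to its second and third components. *)
From HB Require Import structures.
Require Import Defs.
From mathcomp Require Import all_boot all_order all_algebra all_fingroup.
From mathcomp Require Import all_solvable all_field ring.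
Import GRing.Theory.
Local Open Scope ring_scope.

(** * Arithmetic of the primitive prime *)

(** If [p'] divided [m], then [p' - 1 < m], while Fermat gives that [p'] divides [p ^ (p' - 1) - 1],
    against primitivity. *)
Lemma primitive_prime_divisor_coprime {p m p' : nat} :
  prime p -> (1 < m)%N -> primitive_prime_divisor p m p' -> coprime p' m.
Proof.
move=> p_pr m_gt1 [p'_pr p'_dvd p'_min].
have pm_gt0 j : (0 < p ^ j)%N by rewrite expn_gt0 prime_gt0.
have co_p : coprime p p'.
  rewrite coprime_sym prime_coprime //; apply/negP=> p'p.
  have: (p' %| p ^ m)%N by rewrite dvdn_exp // ltnW.
  rewrite -(subnK (pm_gt0 m)) dvdn_addr // dvdn1 => /eqP p'1.
  by rewrite p'1 in p'_pr.
rewrite prime_coprime //; apply/negP=> /(dvdn_leq (ltnW m_gt1)) le_p'm.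
have /p'_min/negP[] : (1 <= p'.-1 < m)%N.
  by rewrite -ltnS prednK ?prime_gt1 ?prime_gt0.
have /eqP := Euler_exp_totient co_p.
by rewrite totient_prime // eqn_mod_dvd.
Qed.

Lemma morphD_additive {U V : zmodType} {f : U -> V} :
  {morph f : x y / x + y} -> exists g : {additive U -> V}, g =1 f.
Proof.
move=> fD.
have f0 : f 0 = 0 by apply: (addIr (f 0)); rewrite -fD !add0r.
pose fA := GRing.isNmodMorphism.Build U V f (f0, fD).
by exists (HB.pack_for {additive U -> V} f fA).
Qed.

(** * Additive maps that turn multiplication by r into multiplication by s *)

Section PrimitiveEigenvectors.
Context {F : finFieldType} {p m p' : nat}.
Hypotheses (p_pr : prime p) (cardF : #|F| = (p ^ m)%N).

(** Otherwise [x] and the images of 0, ..., p - 1 would be p + 1 distinct roots of X^p - X. *)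
Lemma Frobenius_fixed_nat (x : F) : x ^+ p = x -> exists n, x = n%:R.
Proof.
have charFp := card_finPcharP cardF p_pr.
move=> xp; have [/mapP[n _ ->]|xNnat] := boolP (x \in [seq n%:R | n <- iota 0 p]).
  by exists n.
pose rs : seq F := x :: [seq n%:R | n <- iota 0 p].
pose P : {poly F} := 'X^p - 'X.
have sizeP : size P = p.+1.
  by rewrite size_polyDl ?size_polyXn // size_polyN size_polyX ltnS prime_gt1.
have P0 : P != 0 by rewrite -size_poly_eq0 sizeP.
have rootPE y : root P y = (y ^+ p == y).
  by rewrite rootE hornerD hornerN hornerXn hornerX subr_eq0.
suff [] : all (root P) rs /\ uniq rs.
  by move=> /(max_poly_roots P0)/[apply]; rewrite sizeP /= size_map size_iota ltnn.
split.
  rewrite /= rootPE xp eqxx /=; apply/allP=> _ /mapP[n _ ->].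
  by rewrite rootPE -(pFrobenius_autE charFp) pFrobenius_aut_nat.
rewrite /= xNnat map_inj_in_uniq ?iota_uniq // => i j; rewrite !mem_iota /= !add0n.
wlog le_ij : i j / (i <= j)%N => [th ip jp ij|ip jp /eqP].
  by case/orP: (leq_total i j) => ?; [apply: th | apply/esym/th].
rewrite eq_sym -subr_eq0 -natrB // -(dvdn_pcharf charFp) => /dvdnP[[|k] e].
  by apply/eqP; rewrite eqn_leq le_ij -subn_eq0 e.
have := leq_trans (leq_ltn_trans (leq_subr i j) jp) (leq_pmull p (ltn0Sn k)).
by rewrite -e ltnn.
Qed.

(** The product Q of the X - r^(p^j), j < m, has coefficients in the prime field, so additivity
    gives f(Q(r) x) = Q(s) f(x). As Q(r) = 0 and f(x) is nonzero, s is a root of Q. *)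
Lemma additive_eigenvalue {f : {additive F -> F}} {r s x : F} :
  (0 < m)%N -> f x != 0 -> (forall z, f (r * z) = s * f z) ->
  exists2 j, (j < m)%N & s = r ^+ (p ^ j).
Proof.
move=> m_gt0 fx0 frs; have charFp := card_finPcharP cardF p_pr.
pose Q : {poly F} := \prod_(a <- [seq r ^+ (p ^ j) | j <- iota 0 m]) ('X - a%:P).
(* Frobenius shifts the list of roots by one place, and r^(p^m) = r closes the cycle. *)
have Qfix : map_poly (pFrobenius_aut charFp) Q = Q.
  rewrite /Q map_prod_XsubC !big_map -[m]prednK // [in RHS]/= big_cons.
  rewrite -[in LHS]addn1 iotaD big_cat big_seq1 /= add0n mulrC.
  rewrite pFrobenius_autE -exprM -expnSr prednK // -cardF expf_card expn0 expr1.
  congr (_ * _); rewrite (iotaDl 1 0) big_map; apply: eq_bigr => j _.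
  by rewrite pFrobenius_autE -exprM -expnSr.
have Qnat i : exists n, Q`_i = n%:R.
  by apply: Frobenius_fixed_nat; rewrite -{2}Qfix coef_map.
have fpow i z : f (r ^+ i * z) = s ^+ i * f z.
  by elim: i z => [|i IH] z; rewrite ?expr0 ?mul1r // !exprS -!mulrA frs IH.
have fQ : f (Q.[r] * x) = Q.[s] * f x.
  rewrite !horner_coef !mulr_suml raddf_sum; apply: eq_bigr => i _.
  by have [n ->] := Qnat i; rewrite -!mulrA !mulr_natl raddfMn fpow.
have Qr : root Q r.
  by rewrite root_prod_XsubC; apply/mapP; exists 0%N; rewrite ?mem_iota ?expn0 ?expr1.
move/eqP: fQ; rewrite (rootP Qr) mul0r raddf0 eq_sym mulf_eq0 (negPf fx0) orbF.
rewrite -[_ == 0]/(root Q s) root_prod_XsubC => /mapP[j].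
by rewrite mem_iota; exists j.
Qed.

Hypothesis ppd : primitive_prime_divisor p m p'.

(* A \ {0} is a union of free orbits of r, so p' divides p ^ d - 1 where
   d > 0 is the dimension of A; hence d = m. *)
Lemma stable_additive_subset_full {A : {group F}} {r : {unit F}} {x : F} :
  (p' %| #[r]%g)%N -> x \in A -> x != 0 ->
  (forall z, z \in A -> val r * z \in A) -> forall z, z \in A.
Proof.
move=> p'r Ax x0 Ar.
have [p'_pr _ p'_min] := ppd.
have [d le_dm cardA] : exists2 d, (d <= m)%N & #|A| = (p ^ d)%N.
  by apply/(dvdn_pfactor _ _ p_pr); rewrite -cardF -cardsT cardSg // subsetT.
have A0 : 0 \in A := group1 A.
pose B : {set {unit F}} := [set u | val u \in A].
have cardB : #|B| = (p ^ d - 1)%N.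
  have -> : (p ^ d - 1)%N = #|A :\ 0| by rewrite -cardA (cardsD1 0 A) A0 addKn.
  rewrite -(card_imset _ val_inj); apply: eq_card => z.
  rewrite !inE; apply/imsetP/andP=> [[u]|[z0 Az]].
    by rewrite inE => Au ->; rewrite Au -unitfE (valP u).
  have Uz : z \is a GRing.unit by rewrite unitfE.
  by exists (FinRing.unit F Uz); rewrite ?inE.
have actsB : [acts <[r]>%g, on B | 'R].
  rewrite cycle_subG !inE /=; apply/subsetP=> u; rewrite !inE /= => Au.
  by rewrite mulrC Ar.
have p'B : (p' %| #|B|)%N.
  rewrite -(acts_sum_card_orbit actsB); apply: dvdn_sum => _ /imsetP[u _ ->].
  by rewrite orbitR card_lcoset.
have d_gt0 : (0 < d)%N.
  have : (1 < #|A|)%N by apply/card_gt1P; exists 0, x; rewrite eq_sym.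
  by rewrite cardA; case: (d).
have eq_dm : d = m.
  apply/eqP; rewrite eqn_leq le_dm leqNgt; apply/negP=> lt_dm.
  by have := p'_min d; rewrite d_gt0 lt_dm -cardB p'B => /(_ isT).
move=> z; have /eqP-> : A == [set: F] :> {set F}.
  rewrite eqEcard subsetT cardA eq_dm -cardF cardsT; exact: leqnn.
exact: in_setT.
Qed.

(** The solutions z of the claimed equation form an additive subgroup that contains 1 and is stable
    under r, hence all of F. *)
Lemma additive_eigenvector_monomial {f : {additive F -> F}} {r : {unit F}} {j} :
  (p' %| #[r]%g)%N -> (forall z, f (val r * z) = val r ^+ (p ^ j) * f z) ->
  forall z, f z = f 1 * z ^+ (p ^ j).
Proof.
move=> p'r frj z; have charFp := card_finPcharP cardF p_pr.
have pj : [pchar F].-nat (p ^ j)%N.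
  by rewrite (eq_pnat _ (pcharf_eq charFp)) pnatX pnat_id ?orTb.
pose A := [set z | f z == f 1 * z ^+ (p ^ j)].
have gA : group_set A.
  apply/group_setP; split=> [|x y]; rewrite !inE.
    by rewrite raddf0 expr0n expn_eq0 -leqn0 leqNgt prime_gt0 //= mulr0.
  by move=> /eqP Ax /eqP Ay; rewrite raddfD Ax Ay exprDn_pchar // mulrDr.
have := @stable_additive_subset_full (Group gA) r 1 p'r.
rewrite /= !inE expr1n mulr1 eqxx oner_eq0 => /(_ isT isT)-Afull.
have := Afull _ z; rewrite inE => /(_ _)/eqP-> // x.
by rewrite !inE => /eqP Ax; rewrite frj Ax exprMn mulrCA.
Qed.

End PrimitiveEigenvectors.

(** * Linearity over the prime field, and isotopisms under composition *)

(** Scalars act as natural multiples, which every additive map respects. *)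
Lemma Fp_linearP {p : nat} {V : finZmodType} {f : V -> V} :
  reflect {morph f : u v / u + v} (Fp_linear p f).
Proof.
apply: (iffP forallP) => [fL u v | /morphD_additive[g gf] c].
  by have /forallP/(_ u)/forallP/(_ v)/eqP := fL 1; rewrite !mulr1n.
by apply/forallP=> u; apply/forallP=> v; rewrite -!gf raddfD raddfMn.
Qed.

Section Isotopisms.
Context {p : nat} {V : finZmodType}.
Implicit Types (mul : V -> V -> V) (t : triple V).

Lemma isotopismP {mul1 mul2 t} :
  reflect [/\ {morph t.1.1 : u v / u + v}, {morph t.1.2 : u v / u + v},
              {morph t.2 : u v / u + v}
            & forall x y, t.1.1 (mul1 x y) = mul2 (t.1.2 x) (t.2 y)]
          (isotopism p mul1 mul2 t).
Proof.
case: t => [[N L] M] /=; apply: (iffP and4P).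
  case=> /Fp_linearP NL /Fp_linearP LL /Fp_linearP ML /forallP eN.
  by split=> // x y; have /forallP/(_ y)/eqP := eN x.
case=> NL LL ML eN; split; try exact/Fp_linearP.
by apply/forallP=> x; apply/forallP=> y; apply/eqP.
Qed.

Lemma isotopismM {mul1 mul2 mul3 t u} :
  isotopism p mul1 mul2 t -> isotopism p mul2 mul3 u ->
  isotopism p mul1 mul3 (t * u)%g.
Proof.
move=> /isotopismP[tN tL tM t_mul] /isotopismP[uN uL uM u_mul].
apply/isotopismP; split=> x y /=;
  by rewrite !permM (tN, tL, tM, t_mul) (uN, uL, uM, u_mul).
Qed.

Lemma isotopismV {mul1 mul2 t} :
  isotopism p mul1 mul2 t -> isotopism p mul2 mul1 t^-1%g.
Proof.
have invD (s : {perm V}) : {morph s : u v / u + v} -> {morph s^-1%g : u v / u + v}.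
  by move=> sD u v; apply: (@perm_inj _ s); rewrite sD !permKV.
move=> /isotopismP[tN tL tM t_mul]; apply/isotopismP; split; try exact: invD.
by move=> x y /=; apply: (@perm_inj _ t.1.1); rewrite t_mul !permKV.
Qed.

Lemma autotopisms_conjV {mul1 mul2 t} : isotopism p mul1 mul2 t ->
  (autotopisms p mul2 :^ t^-1)%g \subset autotopisms p mul1.
Proof.
move=> iso_t; apply/subsetP=> h; rewrite mem_conjgV !inE conjgE => iso_h.
have -> : h = (t * (t^-1 * (h * t)) * t^-1)%g by rewrite mulKVg mulgK.
exact: isotopismM (isotopismM iso_t iso_h) (isotopismV iso_t).
Qed.

End Isotopisms.

(** * A criterion for a cyclic subgroup to be Sylow *)

(** Let S be a Sylow q-subgroup containing <x>. The normalizer of <x> in S centralizes x, so its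
    index over <x> is a power of q dividing an index prime to q: it equals <x>. Normalizers grow in
    the nilpotent group S, so S = <x>. *)
Lemma Sylow_cycle {gT : finGroupType} {G : {group gT}} {x : gT} {q m : nat} :
  prime q -> coprime q m -> x \in G -> (q.-elt x)%g ->
  (forall g, g \in 'N_G(<[x]>)%g -> (g ^+ m)%g \in 'C[x]%g) ->
  ~~ (q %| #|'C_G(<[x]>) : <[x]>|%g)%N -> (q.-Sylow(G) <[x]>)%g.
Proof.
move=> q_pr co_qm Gx q_x Nm q'C.
have sXG : <[x]>%g \subset G by rewrite cycle_subG.
have [S sylS sXS] := Sylow_superset sXG q_x.
have [sSG qS _] := and3P sylS; have qN := pgroupS (subsetIl S 'N(<[x]>)%g) qS.
have sXN : <[x]>%g \subset 'N_S(<[x]>)%g by rewrite subsetI sXS normG.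
have sNC : 'N_S(<[x]>)%g \subset 'C_G(<[x]>)%g.
  apply/subsetP=> g Ng; have Gg : g \in 'N_G(<[x]>)%g by apply: subsetP Ng; rewrite setSI.
  rewrite inE (subsetP sSG) ?(subsetP (subsetIl _ _) _ Ng) //= cent_cycle.
  (* The order of g is a power of q, hence prime to m, so g is itself a power of g^m. *)
  have /eqP gm : generator <[g]>%g (g ^+ m)%g.
    rewrite generator_coprime; have [n ->] := p_natP (mem_p_elt qN Ng).
    exact: coprimeXl.
  by rewrite -cycle_subG gm cycle_subG Nm.
have sNX : 'N_S(<[x]>)%g \subset <[x]>%g.
  rewrite -indexg_eq1 (pnat_1 (pnat_dvd (dvdn_indexg _ _) qN)) //.
  by rewrite p'natE // (contra _ q'C) // => /dvdn_trans->; rewrite ?indexSg.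
have eqSX := nilpotent_sub_norm (pgroup_nil qS) sXS sNX.
by move: sylS; rewrite eqSX.
Qed.

(** * The triples gamma_r and the maps that intertwine them *)

Section Taniguchi.
Context {F : finFieldType}.
Implicit Types (q : nat) (r s : {unit F}).

(** The two coordinates of the product are homogeneous under (x, y, u, v) -> (rx, ry, ru, rv), with
    factors r^(q+1) and r^(q^2+1). *)
Lemma gamma_autotopism p q (alpha a b : F) r :
  gamma q r \in autotopisms p (taniguchi q alpha a b).
Proof.
rewrite inE; apply/isotopismP; split=> [u v|u v|u v|[x y] [u v]] /=;
  rewrite !permE /= ?permE /=.
- by rewrite !mulrDr.
- by rewrite !mulrDr.
- by rewrite !mulrDr.
rewrite !addn1 !expgS /= !exprMn !FinRing.val_unitX.
by congr (_, _); ring.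
Qed.

Lemma gamma_injm q : ('injm (@gamma_morphism F q))%g.
Proof.
apply/injmP=> r s _ _ [_ /permP/(_ (1, 0)) + _].
by rewrite !permE /= ?permE /= !mulr1 => -[/val_inj].
Qed.

Lemma gammaX q r n : gamma q (r ^+ n)%g = (gamma q r ^+ n)%g.
Proof. exact: (morphX (@gamma_morphism F q) n (in_setT r)). Qed.

Lemma taniguchi_Z_morphim q (R : {group {unit F}}) :
  taniguchi_Z q R = (@gamma_morphism F q @* R)%g.
Proof. by rewrite morphimEsub ?subsetT. Qed.

Section Semilinear.
Context {p m p' : nat}.
Hypotheses (p_pr : prime p) (m_gt0 : (0 < m)%N) (cardF : #|F| = (p ^ m)%N).
Hypothesis ppd : primitive_prime_divisor p m p'.

(** Each entry f of L satisfies f(r z) = s f(z) with the same s, so the exponent j read off from one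
    nonzero entry serves all four. *)
Lemma semilinear_subfunctions {L : {perm (F * F)}} {r s} :
  (p' %| #[r]%g)%N -> {morph L : u v / u + v} ->
  (diag (mulp r) (mulp r) * L = L * diag (mulp s) (mulp s))%g ->
  exists2 j, (j < m)%N & s = (r ^+ (p ^ j))%g /\
    forall f, f \in subfunctions L -> f != 0 -> monomial (p ^ j) f.
Proof.
move=> p'r LD Lrs.
have L0 : L (0, 0) = 0 by apply: (addIr (L 0)); rewrite -LD addr0 add0r.
have LDl x y : L (x + y, 0) = L (x, 0) + L (y, 0).
  by rewrite -LD; congr (L (_, _)); rewrite /= addr0.
have LDr x y : L (0, x + y) = L (0, x) + L (0, y).
  by rewrite -LD; congr (L (_, _)); rewrite /= addr0.
have Lr x y : L (val r * x, val r * y) = (val s * (L (x, y)).1, val s * (L (x, y)).2).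
  by have /permP/(_ (x, y)) := Lrs; rewrite !permM !permE /= ?permE.
have Lrl x : L (val r * x, 0) = (val s * (L (x, 0)).1, val s * (L (x, 0)).2).
  by rewrite -Lr mulr0.
have Lrr x : L (0, val r * x) = (val s * (L (0, x)).1, val s * (L (0, x)).2).
  by rewrite -Lr mulr0.
have subL f : f \in subfunctions L -> (exists g : {additive F -> F}, g =1 f) /\
    forall z, f (val r * z) = val s * f z.
  move=> Lf; split.
    apply: morphD_additive => x y.
    by move: Lf; rewrite !inE => /or4P[]/eqP->; rewrite !ffunE ?LDl ?LDr.
  by move: Lf; rewrite !inE => /or4P[]/eqP-> z; rewrite !ffunE ?Lrl ?Lrr.
(* Injectivity of L makes L(1, 0) nonzero, so an entry of the first column does not vanish at 1. *)
have [f Lf f1] : exists2 f, f \in subfunctions L & f 1 != 0.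
  have : L (1, 0) != 0.
    by apply/eqP=> L10; have /perm_inj[/eqP] := etrans L10 (esym L0); rewrite oner_eq0.
  rewrite -pair_eqE negb_and => /orP[] Li0.
    by exists [ffun x => (L (x, 0)).1]; rewrite ?inE ?eqxx ?orbT // ffunE.
  by exists [ffun x => (L (x, 0)).2]; rewrite ?inE ?eqxx ?orbT // ffunE.
have [j lt_jm sE] : exists2 j, (j < m)%N & val s = val r ^+ (p ^ j).
  have [[g gf] frs] := subL f Lf.
  apply: (@additive_eigenvalue _ _ _ p_pr cardF g _ _ 1 m_gt0); rewrite ?gf // => z.
  by rewrite !gf.
exists j => //; split=> [|h Lh h0]; first by apply: val_inj; rewrite FinRing.val_unitX.
have [[g gh] hrs] := subL h Lh.
have hE z : h z = h 1 * z ^+ (p ^ j).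
  rewrite -!gh; apply: (additive_eigenvector_monomial p_pr cardF ppd p'r) => // y.
  by rewrite !gh hrs sE.
exists (h 1) => //; apply: contraNneq h0 => h1.
by apply/eqP/ffunP=> z; rewrite hE h1 mul0r ffunE.
Qed.

End Semilinear.

End Taniguchi.

(** * Z_R as a Sylow subgroup of the autotopism group *)

Section TaniguchiSylow.
Context {F : finFieldType} {p m p' : nat} {R : {group {unit F}}}.
Hypotheses (p_pr : prime p) (m_gt1 : (1 < m)%N) (cardF : #|F| = (p ^ m)%N).
Hypothesis ppd : primitive_prime_divisor p m p'.
Hypothesis sylR : (p'.-Sylow([set: {unit F}]) R)%g.

Lemma Sylow_unit_generator : exists2 r, R = <[r]>%G & (p' %| #[r]%g)%N.
Proof.
have [p'_pr p'_dvd _] := ppd; have /cyclicP[r Rr] := field_unit_group_cyclic R.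
exists r; first exact: val_inj.
rewrite orderE -Rr (card_Hall sylR) card_finField_unit cardF -subn1.
rewrite p_part (dvdn_exp2l _ (_ : 1 <= _)%N) //= logn_gt0 mem_primes p'_pr p'_dvd andbT.
by rewrite subn_gt0 -(expn0 p) ltn_exp2l ?prime_gt1 // ltnW.
Qed.

Lemma gamma_conj_Frobenius {q} {alpha a b : F} {r s : {unit F}} {t : triple (F * F)%type} :
  (p' %| #[r]%g)%N -> t \in autotopisms p (taniguchi q alpha a b) ->
  (gamma q r ^ t = gamma q s)%g ->
  exists j, s = (r ^+ (p ^ j))%g.
Proof.
move=> p'r; rewrite inE => /isotopismP[_ LD _ _] /(canRL (mulKVg _)).
case: t LD => [[N L] M] /= LD [_ Lrs _].
have [j _ [sE _]] :=
  semilinear_subfunctions p_pr (ltnW m_gt1) cardF ppd p'r LD Lrs.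
by exists j.
Qed.

Lemma taniguchi_Z_Sylow {q} {alpha a b : F} :
  let C := taniguchi_C p q alpha a b R in
  let Z := taniguchi_Z q [set: {unit F}] in
  Z \subset C -> ~~ (p' %| #|C : Z|%g)%N ->
  (p'.-Sylow(autotopisms p (taniguchi q alpha a b)) (taniguchi_Z q R))%g.
Proof.
move=> C Z sZC p'C; have [p'_pr _ _] := ppd.
have [r RE p'r] := Sylow_unit_generator.
have ZRE : taniguchi_Z q R = <[gamma q r]>%g.
  by rewrite taniguchi_Z_morphim RE morphim_cycle ?inE.
have Rpgroup := pHall_pgroup sylR.
rewrite ZRE; apply: (@Sylow_cycle _ _ _ p' m) => //.
- exact: primitive_prime_divisor_coprime ppd.
- exact: gamma_autotopism.
- rewrite /p_elt orderE -ZRE taniguchi_Z_morphim; exact: morphim_pgroup.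
- move=> t /setIP[At Nt].
  have [s Rs xt] : exists2 s, s \in R & (gamma q r ^ t = gamma q s)%g.
    apply/imsetP; rewrite -/(taniguchi_Z q R) ZRE memJ_norm ?cycle_id //.
  have [j sE] := gamma_conj_Frobenius p'r At xt.
  (* Conjugation by t acts on r as the p^j-th power, so t^m acts as the (p^m)^j-th power, which is
     trivial on F. *)
  have conjXE n : (gamma q r ^ (t ^+ n) = gamma q (r ^+ (p ^ (j * n))))%g.
    elim: n => [|n IH]; first by rewrite conjg1 muln0 expn0 expg1.
    rewrite expgSr conjgM IH gammaX conjXg xt sE.
    by rewrite -gammaX -expgM -expnD mulnS.
  apply/cent1P/esym/commgP/conjg_fixP; rewrite conjXE; congr (gamma q _).
  apply: val_inj; rewrite FinRing.val_unitX mulnC expnM -cardF.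
  by elim: (j) => [|i IH]; rewrite ?expn0 ?expr1 // expnS exprM expf_card.
(* The index of Z_R in C is |C : Z| |Z : Z_R|. The first factor is prime to p' by hypothesis, the
   second because it is the index of R in the unit group. *)
rewrite -ZRE.
have sRZ : taniguchi_Z q R \subset Z by apply: imsetS; apply: subsetT.
pose CG := 'C_(autotopisms_group p (taniguchi q alpha a b))(taniguchi_Z q R)%G.
rewrite -(@Lagrange_index _ CG (taniguchi_Z_group q [set: {unit F}])
  (taniguchi_Z_group q R)) //.
rewrite Euclid_dvdM // negb_or p'C /= !taniguchi_Z_morphim.
rewrite index_injm ?gamma_injm ?subsetT // -p'natE //.
by have /and3P[] := sylR.
Qed.

End TaniguchiSylow.

(** * From an arbitrary isotopism to a monomial one *)

Theorem theorem1 (p m : nat) (F : finFieldType) (k1 k2 p' : nat)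
  (R : {group {unit F}}) (alpha1 a1 b1 alpha2 a2 b2 : F) :
  prime p -> (2 < m)%N -> (p, m) <> (2%N, 6%N) -> #|F| = (p ^ m)%N ->
  (0 < k1)%N -> (2 * k1 < m)%N -> (0 < k2)%N -> (2 * k2 <= m)%N ->
  taniguchi_params (p ^ k1) alpha1 a1 b1 ->
  taniguchi_params (p ^ k2) alpha2 a2 b2 ->
  primitive_prime_divisor p m p' ->
  (p'.-Sylow([set: {unit F}]) R)%g ->
  let C := taniguchi_C p (p ^ k1) alpha1 a1 b1 R in
  let Z := taniguchi_Z (p ^ k1) [set: {unit F}] in
  Z \subset C -> ~~ (p' %| #|C : Z|%g)%N ->
  let P1 := taniguchi (p ^ k1) alpha1 a1 b1 in
  let P2 := taniguchi (p ^ k2) alpha2 a2 b2 in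
  isotopic p P1 P2 ->
  exists N L M : {perm (F * F)},
    [/\ isotopism p P1 P2 (N, L, M),
        exists2 j, (j < m)%N &
          forall f, f \in subfunctions L -> f != 0 -> monomial (p ^ j) f
      & exists2 j, (j < m)%N &
          forall f, f \in subfunctions M -> f != 0 -> monomial (p ^ j) f].
Proof.
move=> p_pr m_gt2 _ cardF _ _ _ _ _ _ ppd sylR C Z sZC p'C P1 P2 [t iso_t].
have m_gt1 := ltnW m_gt2; have m_gt0 := ltnW m_gt1.
have sylZ1 := taniguchi_Z_Sylow p_pr m_gt1 cardF ppd sylR sZC p'C.
have [r RE p'r] := Sylow_unit_generator p_pr m_gt1 cardF ppd sylR.
pose Z2 := taniguchi_Z_group (p ^ k2) R.
have sylZ2 : (p'.-Sylow(autotopisms p P1) (Z2 :^ t^-1))%g.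
  rewrite pHallE -(card_Hall sylZ1) cardJg; apply/andP; split.
    apply: subset_trans (autotopisms_conjV iso_t); rewrite conjSg.
    by apply/subsetP=> _ /imsetP[s _ ->]; apply: gamma_autotopism.
  (* Both copies of Z_R have order |R|, since each [gamma] is injective. *)
  by rewrite /Z2 /= !taniguchi_Z_morphim !card_injm ?gamma_injm ?subsetT.
have [g Ag Z2E] := Sylow_trans sylZ1 sylZ2.
have iso_gt : isotopism p P1 P2 (g * t)%g.
  by apply: isotopismM iso_t; rewrite inE in Ag.
(* Products act from left to right: g * t applies the autotopism g of P1 first, and conjugation by
   it carries Z_R for P1 onto Z_R for P2. *)
have [s _ rs] : exists2 s, s \in R & (gamma (p ^ k1) r ^ (g * t) = gamma (p ^ k2) s)%g.
  apply/imsetP; rewrite -/(taniguchi_Z (p ^ k2) R).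
  have -> : taniguchi_Z (p ^ k2) R = (taniguchi_Z (p ^ k1) R :^ (g * t))%g.
    by rewrite conjsgM -Z2E conjsgKV.
  by rewrite memJ_conjg imset_f // RE cycle_id.
(* Rewritten as gamma_r (g t) = (g t) gamma_s, the relation is read in the second and third
   components, where both gammas are scalar multiplications. *)
case: (g * t)%g iso_gt rs => [[N L] M] iso_NLM /(canRL (mulKVg _))[_ Lrs Mrs].
have [/= _ LD MD _] := isotopismP iso_NLM.
have [i lt_im [_ Lmon]] :=
  semilinear_subfunctions p_pr m_gt0 cardF ppd p'r LD Lrs.
have [j lt_jm [_ Mmon]] :=
  semilinear_subfunctions p_pr m_gt0 cardF ppd p'r MD Mrs.
by exists N, L, M; split=> //; [exists i | exists j].
Qed.
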